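(* Consider the two-user fading interference channel of the context with $\alpha\ge2$, block length $N=1$ and multiplexing rates $r_1,r_2\in[0,1]$, with a stripping decoder at each receiver. If both users employ sequences of codebooks that are DMT-optimal for the single-input single-output (SISO) channel, then this results in DMT-optimality for the interference channel, i.e. $$P(E)\doteq\mathsf{SNR}^{-\min\{(1-r_1)^+,\,(1-r_2)^+\}}.$$
   Context: **Exponential equality.** For positive functions $f,g$ of $\mathsf{SNR}$, $f\doteq g$ means $\lim_{\mathsf{SNR}\to\infty}\frac{\log f}{\log\mathsf{SNR}}=\lim_{\mathsf{SNR}\to\infty}\frac{\log g}{\log\mathsf{SNR}}$. Logarithms are to base 2 and $(a)^+=\max(a,0)$. **System model ($N=1$).** Two transmitters $\mathcal T_1,\mathcal T_2$ and two receivers $\mathcal R_1,\mathcal R_2$ with $$y_1=\sqrt{\mathsf{SNR}}\,h_{11}x_1+\sqrt{\mathsf{SNR}^\alpha}\,h_{21}x_2+z_1,\qquad y_2=\sqrt{\mathsf{SNR}^\alpha}\,h_{12}x_1+\sqrt{\mathsf{SNR}}\,h_{22}x_2+z_2,$$ with $\alpha$ finite, noise $z_i\sim\mathcal{CN}(0,1)$ and fading coefficients $h_{ij}\sim\mathcal{CN}(0,1)$, all independent. $\mathcal R_i$ knows $\mathbf h_i=[h_{1i}\ h_{2i}]^T$, $\mathsf{SNR}$ and $\alpha$; transmitters know only the channel statistics, $\mathsf{SNR}$ and $\alpha$. $\mathcal T_i$ has rate $r_i\log\mathsf{SNR}$ and uses a sequence of codebooks $\mathcal X_i\subset\mathbb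 C$, one for each $\mathsf{SNR}$, with $|\mathcal X_i|=\mathsf{SNR}^{r_i}$ and $|x|^2\le1$ for $x\in\mathcal X_i$. Symbols are equally likely and independent across users. **SISO DMT-optimality.** A sequence of codebooks of multiplexing rate $r$ is DMT-optimal for the SISO channel if on $y=\sqrt{\mathsf{SNR}}\,hx+z$, $h,z\sim\mathcal{CN}(0,1)$ independent, $h$ known at the receiver, its channel-averaged ML error probability is $\doteq\mathsf{SNR}^{-(1-r)^+}$. **Stripping decoder.** At $\mathcal R_i$ ($j\ne i$): first decode the interfering symbol $x_j$ from $y_i$ by ML decoding treating the intended signal as noise (i.e. as additive Gaussian noise, the total effective noise having variance $1+\mathsf{SNR}|h_{ii}|^2$), obtaining $\bar x_j$; then subtract $\sqrt{\mathsf{SNR}^\alpha}h_{ji}\bar x_j$ from $y_i$; then ML-decode $x_i$ from the result as if the interference had been removed perfectly. $P(E_{ii})$ is the channel-averaged probability that $x_i$ is decoded incorrectly at $\mathcal R_i$, and $P(E)=\max\{P(E_{11}),P(E_{22})\}$. The optimal DMT of the interference channel for $\alpha\ge2$ is $\min\{(1-r_1)^+,(1-r_2)^+\}$. *)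

(* Defs.v *)
From HB Require Import structures.
From mathcomp Require Import all_boot all_order all_algebra.
From mathcomp Require Import finmap complex.
From mathcomp Require Import all_classical all_reals all_analysis.

Set Implicit Arguments.
Unset Strict Implicit.
Unset Printing Implicit Defensive.

Import Order.TTheory GRing.Theory Num.Theory.
Import numFieldNormedType.Exports.

Local Open Scope classical_set_scope.
Local Open Scope ring_scope.
Local Open Scope complex_scope.

Definition log2 {R : realType} (x : R) : R := ln x / ln 2.

Definition pos_part {R : realType} (a : R) : R := Num.max a 0.

(* Since [ln] is a total function with [ln 0 = 0], positivity of both sides has
   to be part of the relation. *)
Definition exp_eq {R : realType} (f g : R -> R) : Prop :=
  [/\ \forall s \near +oo, 0 < f s,
      \forall s \near +oo, 0 < g s
    & exists l : R,
        (log2 (f s) / log2 s @[s --> +oo] --> l) /\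
        (log2 (g s) / log2 s @[s --> +oo] --> l)].

Notation "f '=.=' g" := (exp_eq f g) (at level 70, no associativity).

Definition sqmod {R : realType} (x : R[i]) : R := Normc.normc x ^+ 2.

(* CN(0,1), carried by pairs (real part, imaginary part): independent real and
   imaginary parts, each of variance 1/2; the second argument of [normal_prob]
   is the standard deviation. *)
Definition half_normal {R : realType} : probability (measurableTypeR R) R :=
  normal_prob (0 : R) (Num.sqrt 2^-1).

Definition CN01 {R : realType} :
    probability (measurableTypeR R * measurableTypeR R)%type R :=
  (half_normal \x half_normal)%E.

Definition cplx {R : realType} (p : R * R) : R[i] := p.1 +i* p.2.

(* Density at [y] of CN(m, v). *)
Definition cn_pdf {R : realType} (m : R[i]) (v : R) (y : R[i]) : R :=
  expR (- (sqmod (y - m) / v)) / (pi * v).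

(* The codeword of [X] maximizing the likelihood [lik]. Ties are broken by the
   enumeration of [X]; the value 0 is a dummy for the empty codebook. *)
Definition ml_decode {R : realType} (X : {fset R[i]}) (lik : R[i] -> R) : R[i] :=
  if [pick x : X | [forall x' : X, lik (val x') <= lik (val x)]] is Some x
  then val x else 0.

Section channels.
Context {R : realType}.
Implicit Types (s alpha : R) (h hd hc x z y : R[i]) (X Xi Xj : {fset R[i]}).

Definition siso_gain s h : R[i] := (Num.sqrt s)%:C * h.

Definition cross_gain alpha s h : R[i] := (Num.sqrt (s `^ alpha))%:C * h.

Definition siso_output s h x z : R[i] := siso_gain s h * x + z.

Definition siso_decode s X h y : R[i] :=
  ml_decode X (fun x => cn_pdf (siso_gain s h * x) 1 y).

Definition siso_error s X : R :=
  (#|` X|)%:R^-1 * \sum_(x <- X)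
    fine ((CN01 \x CN01)%E
      [set w : (R * R) * (R * R) |
        let h := cplx w.1 in let z := cplx w.2 in
        siso_decode s X h (siso_output s h x z) != x]).

(* Output at a receiver with direct coefficient [hd], from its own transmitter
   sending [xi], and cross coefficient [hc], from the other transmitter sending
   [xj]: (hd, hc) is (h11, h21) at receiver 1 and (h22, h12) at receiver 2. *)
Definition ic_output alpha s hd hc xi xj z : R[i] :=
  siso_gain s hd * xi + cross_gain alpha s hc * xj + z.

Definition interference_decode alpha s Xj hd hc y : R[i] :=
  ml_decode Xj (fun xj =>
    cn_pdf (cross_gain alpha s hc * xj) (1 + s * sqmod hd) y).

Definition stripping_decode alpha s Xi Xj hd hc y : R[i] :=
  let xj := interference_decode alpha s Xj hd hc y in
  siso_decode s Xi hd (y - cross_gain alpha s hc * xj).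

(* P(E_ii): error probability at the receiver of the user with codebook [Xi],
   the other user having codebook [Xj], averaged over the two fading
   coefficients and the noise at that receiver and over both symbols, the only
   random variables the error event depends on. *)
Definition stripping_error alpha s Xi Xj : R :=
  (#|` Xi| * #|` Xj|)%N%:R^-1 * \sum_(xi <- Xi) \sum_(xj <- Xj)
    fine (((CN01 \x CN01) \x CN01)%E
      [set w : (R * R) * (R * R) * (R * R) |
        let hd := cplx w.1.1 in let hc := cplx w.1.2 in let z := cplx w.2 in
        stripping_decode alpha s Xi Xj hd hc
          (ic_output alpha s hd hc xi xj z) != xi]).

End channels.

(* A codebook for each SNR, of unit peak power and multiplexing rate [r]. As
   SNR^r is in general not an integer, |X| = SNR^r is read as an exponential
   equality, which covers any rounding. *)
Definition codebooks {R : realType} (r : R) (X : R -> {fset R[i]}) : Prop :=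
  ((fun s => (#|` X s|)%:R) =.= (fun s => s `^ r)) /\
  (forall s, 0 < s -> forall x, x \in X s -> sqmod x <= 1).

Definition siso_dmt_optimal {R : realType} (r : R) (X : R -> {fset R[i]}) : Prop :=
  (fun s => siso_error s (X s)) =.= (fun s => s `^ (- pos_part (1 - r))).

Definition ic_error {R : realType} (alpha : R) (X1 X2 : R -> {fset R[i]}) (s : R) : R :=
  Num.max (stripping_error alpha s (X1 s) (X2 s))
          (stripping_error alpha s (X2 s) (X1 s)).

(* Main.v *)
Require Import Defs.
From HB Require Import structures.
From mathcomp Require Import all_boot all_order all_algebra.
From mathcomp Require Import finmap complex.
From mathcomp Require Import all_classical all_reals all_analysis.
From mathcomp Require Import measurable_realfun ring lra.

Set Implicit Arguments.
Unset Strict Implicit.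
Unset Printing Implicit Defensive.

Import Order.TTheory GRing.Theory Num.Theory.
Import numFieldNormedType.Exports.

Local Open Scope classical_set_scope.
Local Open Scope ring_scope.
Local Open Scope complex_scope.

(* Let [e_i] be the SISO error probability of the codebook of user [i]. For
   [SNR >= 1] and [alpha >= 2] one has [e_i <= P(E_ii) <= e_i + 48 e_j], which
   determines the exponent of [max(P(E_11), P(E_22))].

   Lower bound: a genie that reveals the interfering symbol turns the receiver
   into that of a SISO channel, where maximum likelihood is optimal.

   Upper bound: both decoders are nearest-point rules, so the set of noises that
   are decoded correctly is convex. At the first stage, rescaled to have gain
   [sqrt SNR * h_ji / 4], the effective noise is a combination of [z], [+/- h_ii]
   and [+/- i h_ii] with nonnegative weights of sum at most 3/4; each of these is
   CN(0,1) and independent of [h_ji]. Replacing [h] by [h / 4] increases a probability by at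
   most the factor 16, by comparison of densities; a union bound over the three
   noises gives 48. *)

(** * Integration against a measure given by a density *)

Section density.
Context d (T : measurableType d) (R : realType).
Local Open Scope ereal_scope.
Variables (mu nu : {measure set T -> \bar R}) (p : T -> R).
Hypotheses (p0 : forall x, (0 <= p x)%R) (mp : measurable_fun setT p).
Hypothesis nuE : forall A, measurable A -> nu A = \int[mu]_(x in A) (p x)%:E.

Import HBNNSimple.

(** Monotone convergence along simple functions reduces this to indicators, where it is [nuE]. *)
Lemma ge0_integral_density (f : T -> \bar R) :
  measurable_fun setT f -> (forall x, 0 <= f x) ->
  \int[nu]_x f x = \int[mu]_x (f x * (p x)%:E).
Proof.
move=> mf f0; pose g := nnsfun_approx measurableT mf.
have gf x : (g n x)%:E @[n --> \oo] --> f x by exact: cvg_nnsfun_approx.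
have ndg x : {homo (fun n => (g n x)%:E) : a b / (a <= b)%N >-> a <= b}.
  by move=> a b ab; rewrite lee_fin; exact/lefP/nd_nnsfun_approx.
transitivity (limn (fun n => \int[nu]_x (g n x)%:E)).
  rewrite -monotone_convergence//; last 2 first.
  - by move=> n; exact/measurable_EFinP.
  - by move=> n x _; rewrite lee_fin.
  by apply: eq_integral => x _; apply/esym/cvg_lim => //; exact: gf.
transitivity (limn (fun n => \int[mu]_x ((g n x)%:E * (p x)%:E))); last first.
  rewrite -monotone_convergence//; last 3 first.
  - by move=> n; apply: emeasurable_funM; exact/measurable_EFinP.
  - by move=> n x _; rewrite mule_ge0 ?lee_fin.
  - by move=> x _ a b ab; rewrite lee_wpmul2r ?lee_fin//; exact: ndg.
  apply: eq_integral => x _; apply/cvg_lim => //.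
  by apply: cvgeZr => //; exact: gf.
congr (limn _); apply/funext => n.
rewrite integralT_nnsfun sintegralE.
under [in RHS]eq_integral => x _.
  rewrite fimfunE -fsumEFin// ge0_mule_fsuml; last first.
    by move=> r; exact: nnfun_muleindic_ge0.
  over.
rewrite ge0_integral_fsum//; last 2 first.
  move=> r; apply: emeasurable_funM; last exact/measurable_EFinP.
  exact/measurable_EFinP/measurable_funM.
  by move=> r x _; rewrite mule_ge0 ?lee_fin//; exact: nnfun_muleindic_ge0.
apply: eq_fsbigr => r /[!inE] -[x _ <-].
under [in RHS]eq_integral => y _ do rewrite EFinM -muleA.
rewrite ge0_integralZl//; last 3 first.
- apply: emeasurable_funM; exact/measurable_EFinP.
- by move=> y _; rewrite mule_ge0 ?lee_fin.
- by rewrite lee_fin.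
congr (_ * _); rewrite nuE// integral_mkcond.
apply: eq_integral => y _; rewrite patchE indicE.
by case: ifP => _; rewrite ?mul1e ?mul0e.
Qed.

End density.

(** The existential bundles the image with its structure of measure, so that uniqueness theorems can
    be applied to [nu]. *)
Lemma pushforward_measure d d' (T : measurableType d) (T' : measurableType d')
    (R : realType) (mu : {measure set T -> \bar R}) (f : T -> T') :
  measurable_fun setT f ->
  exists nu : {measure set T' -> \bar R}, forall A, nu A = mu (f @^-1` A).
Proof. by move=> mf; unshelve eexists (pushforward mu f). Qed.

(** * Lebesgue measure under translation and scaling *)

Section lebesgue_affine.
Context {R : realType}.
Local Open Scope ereal_scope.
Notation mu := (@lebesgue_measure R).

Lemma lebesgue_measure_translate (m : R) (A : set R) : measurable A ->
  mu ((fun x => x + m)%R @^-1` A) = mu A.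
Proof.
have mf : measurable_fun setT
    ((fun x => (x + m)%R) : measurableTypeR R -> measurableTypeR R).
  exact: measurable_funD.
have [nu nuE] := pushforward_measure mu mf.
move=> mA; rewrite -nuE; apply/esym/lebesgue_measure_unique => //= _ [[a b]] _ <-.
rewrite nuE.
have -> : (fun x => x + m)%R @^-1` `]a, b] = `](a - m)%R, (b - m)%R]%classic.
  by apply/seteqP; split => x /=; rewrite !in_itv/= ltrBlDr lerBrDr.
rewrite lebesgue_measure_itv [RHS]lebesgue_measure_itv/= !lte_fin ltrD2r.
by rewrite -!EFinB opprB addrA subrK.
Qed.

Lemma lebesgue_measure_scale (c : R) (A : set R) : (0 < c)%R -> measurable A ->
  mu ((fun x => c * x)%R @^-1` A) = c^-1%:E * mu A.
Proof.
move=> c0 mA.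
have mf : measurable_fun setT
    ((fun x => (c * x)%R) : measurableTypeR R -> measurableTypeR R).
  by apply: measurable_funM.
have [nu nuE] := pushforward_measure mu mf.
(* Uniqueness of Lebesgue measure: [c] times the image measure gives half-open intervals their
   length. *)
have -> : mu A = mscale (NngNum (ltW c0)) nu A.
  apply: lebesgue_measure_unique => //= _ [[a b]] _ <-.
  rewrite /mscale/= nuE.
  have -> : (fun x => c * x)%R @^-1` `]a, b] =
      `](c^-1 * a)%R, (c^-1 * b)%R]%classic.
    by apply/seteqP; split => x /=; rewrite !in_itv/= ltr_pdivrMl// ler_pdivlMl.
  rewrite lebesgue_measure_itv [X in _ = _ * X]lebesgue_measure_itv/= !lte_fin.
  rewrite ltr_pM2l ?invr_gt0//.
  case: ifP => _; last by rewrite mule0.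
  by rewrite -!EFinB -EFinM -mulrBr mulrA divff ?mul1r// gt_eqF.
by rewrite /mscale/= muleA -EFinM mulVf ?gt_eqF// mul1e nuE.
Qed.

End lebesgue_affine.

(** * Real Gaussian laws under affine maps *)

Section normal_affine.
Context {R : realType}.
Local Open Scope ereal_scope.
Notation mu := (@lebesgue_measure R).
Implicit Types (m sigma c : R) (A : set R).

Let measurable_pdf m sigma D :
  measurable_fun D (fun x : measurableTypeR R => (normal_pdf m sigma x)%:E).
Proof.
apply: measurable_funTS; apply/measurable_EFinP; exact: measurable_normal_pdf.
Qed.

Lemma normal_prob_translate m sigma A : (sigma != 0)%R -> measurable A ->
  normal_prob 0 sigma ((fun x => x + m)%R @^-1` A) = normal_prob m sigma A.
Proof.
move=> s0 mA; rewrite /normal_prob.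
have mf : measurable_fun setT
    ((fun x => (x + m)%R) : measurableTypeR R -> measurableTypeR R).
  exact: measurable_funD.
have [nu nuE] := pushforward_measure mu mf.
(* Lebesgue measure is replaced by its own translate, so that the change of variables moves the
   shift into the density. *)
rewrite [RHS](eq_measure_integral (pushforward mu
  (fun x : measurableTypeR R => (x + m)%R : measurableTypeR R))); last first.
  by move=> B mB _; exact/esym/lebesgue_measure_translate.
rewrite ge0_integral_pushforward//; last first.
  by move=> x _; rewrite lee_fin normal_pdf_ge0.
apply: eq_integral => x _ /=.
by rewrite !normal_pdfE// /normal_fun subr0 addrK.
Qed.

Lemma normal_probN sigma A : (sigma != 0)%R -> measurable A ->
  normal_prob 0 sigma (-%R @^-1` A) = normal_prob 0 sigma A.
Proof.
move=> s0 mA; rewrite /normal_prob.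
rewrite [RHS](eq_measure_integral (pushforward mu
  (-%R : measurableTypeR R -> measurableTypeR R))); last first.
  by move=> B mB _; exact/esym/lebesgue_measureN.
rewrite ge0_integral_pushforward//; last first.
  by move=> x _; rewrite lee_fin normal_pdf_ge0.
apply: eq_integral => x _ /=.
by rewrite !normal_pdfE// /normal_fun !subr0 sqrrN.
Qed.

(* The density at [x / c] is at most the density at [x] for [0 < c <= 1]. *)
Lemma normal_prob_scale sigma c A :
  (sigma != 0)%R -> (0 < c <= 1)%R -> measurable A ->
  normal_prob 0 sigma ((fun x => c * x)%R @^-1` A) <=
  c^-1%:E * normal_prob 0 sigma A.
Proof.
move=> s0 /andP[c0 c1] mA; rewrite /normal_prob.
have mf : measurable_fun setT
    ((fun x => (c * x)%R) : measurableTypeR R -> measurableTypeR R).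
  by apply: measurable_funM.
have cV0 : (0 <= c^-1)%R by rewrite invr_ge0 ltW.
(* The factor [c^-1] is absorbed into the measure: [c^-1 mu] is the image of [mu] under
   multiplication by [c]. *)
have cE : c^-1%:E * \int[mu]_(x in A) (normal_pdf 0 sigma x)%:E =
    \int[mscale (NngNum cV0) mu]_(x in A) (normal_pdf 0 sigma x)%:E.
  rewrite ge0_integral_mscale//.
  by move=> x _; rewrite lee_fin normal_pdf_ge0.
rewrite cE [leRHS](eq_measure_integral (pushforward mu
  (fun x : measurableTypeR R => (c * x)%R : measurableTypeR R))); last first.
  by move=> B mB _; exact/esym/lebesgue_measure_scale.
rewrite ge0_integral_pushforward//; last first.
  by move=> x _; rewrite lee_fin normal_pdf_ge0.
apply: ge0_le_integral => //.
- by rewrite -[X in measurable X]setTI; exact: mf.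
- by move=> x _; rewrite lee_fin normal_pdf_ge0.
- apply: measurable_funTS; apply: measurableT_comp => //; exact: mf.
move=> x _ /=; rewrite lee_fin !normal_pdfE// ler_wpM2l ?normal_peak_ge0//.
rewrite ler_expR !subr0 !mulNr lerN2 ler_wpM2r//.
  by rewrite invr_ge0 mulrn_wge0// sqr_ge0.
rewrite exprMn ler_piMl ?sqr_ge0// expr_le1// ltW//.
Qed.

Lemma ge0_integral_normal_prob m sigma (f : measurableTypeR R -> \bar R) :
  measurable_fun setT f -> (forall x, 0 <= f x) ->
  \int[normal_prob m sigma]_x f x =
  \int[mu]_x (f x * (normal_pdf m sigma x)%:E).
Proof.
move=> mf f0; apply: ge0_integral_density => //.
- by move=> x; exact: normal_pdf_ge0.
- exact: measurable_normal_pdf.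
Qed.

End normal_affine.

(** * Product measures: joint laws, sections and comparisons *)

Section product_measures.
Context d1 d2 (T1 : measurableType d1) (T2 : measurableType d2) (R : realType).
Local Open Scope ereal_scope.

Lemma measurable_pair_preimage d (T : measurableType d) (f : T -> T1)
    (g : T -> T2) (A : set (T1 * T2)) :
  measurable_fun setT f -> measurable_fun setT g -> measurable A ->
  measurable [set w | A (f w, g w)].
Proof.
move=> mf mg mA; rewrite -[X in measurable X]setTI.
exact: (measurable_fun_pair mf mg).
Qed.

(** A joint law is determined by its values on rectangles; this identifies the law of two
    independent coordinates. *)
Lemma product_measure_law d (T : measurableType d) (mu : {measure set T -> \bar R})
    (m1 : {sigma_finite_measure set T1 -> \bar R})
    (m2 : {sigma_finite_measure set T2 -> \bar R}) (f : T -> T1) (g : T -> T2) :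
  measurable_fun setT f -> measurable_fun setT g ->
  (forall A B, measurable A -> measurable B ->
    mu (f @^-1` A `&` g @^-1` B) = m1 A * m2 B) ->
  forall X, measurable X -> mu ((fun w => (f w, g w)) @^-1` X) = (m1 \x m2) X.
Proof.
move=> mf mg H X mX.
have mfg : measurable_fun setT (fun w => (f w, g w)) by exact: measurable_fun_pair.
have [nu nuE] := pushforward_measure mu mfg.
rewrite -nuE; apply/esym/product_measure_unique => // A B mA mB.
by rewrite nuE -H.
Qed.

(** The product integrated in the opposite order agrees on rectangles, hence everywhere. *)
Lemma product_measure_ysection (m1 : {sigma_finite_measure set T1 -> \bar R})
    (m2 : {sigma_finite_measure set T2 -> \bar R}) (A : set (T1 * T2)) :
  measurable A -> (m1 \x m2) A = \int[m2]_y m1 (ysection A y).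
Proof.
move=> mA; transitivity ((m1 \x^ m2) A) => //.
by apply: product_measure_unique => // *; exact: product_measure2E.
Qed.

Lemma le_product_measure_preimage_l
    (m1 m1' : {sigma_finite_measure set T1 -> \bar R})
    (m2 : {sigma_finite_measure set T2 -> \bar R}) (f : T1 -> T1) (c : R) :
  measurable_fun setT f -> (0 <= c)%R ->
  (forall A, measurable A -> m1 (f @^-1` A) <= c%:E * m1' A) ->
  forall X, measurable X ->
    (m1 \x m2) ((fun p => (f p.1, p.2)) @^-1` X) <= c%:E * (m1' \x m2) X.
Proof.
move=> mf c0 H X mX.
have mf2 : measurable_fun setT (fun p : T1 * T2 => (f p.1, p.2)).
  by apply: measurable_fun_pair => //; exact: measurableT_comp.
have mfX : measurable ((fun p => (f p.1, p.2)) @^-1` X).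
  by rewrite -[X in measurable X]setTI; exact: mf2.
rewrite !product_measure_ysection// -ge0_integralZl//; last first.
  exact: measurable_fun_ysection.
apply: ge0_le_integral => //.
- exact: measurable_fun_ysection.
- by apply: measurable_funeM; exact: measurable_fun_ysection.
by move=> y _; exact: (H _ (measurable_ysection y mX)).
Qed.

Lemma le_product_measure_preimage_r
    (m1 : {sigma_finite_measure set T1 -> \bar R})
    (m2 m2' : {sigma_finite_measure set T2 -> \bar R}) (f : T2 -> T2) (c : R) :
  measurable_fun setT f -> (0 <= c)%R ->
  (forall A, measurable A -> m2 (f @^-1` A) <= c%:E * m2' A) ->
  forall X, measurable X ->
    (m1 \x m2) ((fun p => (p.1, f p.2)) @^-1` X) <= c%:E * (m1 \x m2') X.
Proof.
move=> mf c0 H X mX.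
have mf2 : measurable_fun setT (fun p : T1 * T2 => (p.1, f p.2)).
  by apply: measurable_fun_pair => //; exact: measurableT_comp.
have mfX : measurable ((fun p => (p.1, f p.2)) @^-1` X).
  by rewrite -[X in measurable X]setTI; exact: mf2.
rewrite /product_measure1 -ge0_integralZl//; last first.
  exact: measurable_fun_xsection.
apply: ge0_le_integral => //.
- exact: measurable_fun_xsection.
- by apply: measurable_funeM; exact: measurable_fun_xsection.
by move=> x _; exact: (H _ (measurable_xsection x mX)).
Qed.

(** For a fixed first coordinate only the sums are compared, not their terms: maximum likelihood is
    optimal on average over the symbols, not symbol by symbol. *)
Lemma le_sum_product_measure (m1 : {measure set T1 -> \bar R})
    (m2 : {sigma_finite_measure set T2 -> \bar R}) (I : Type) (r : seq I)
    (A B : I -> set (T1 * T2)) :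
  (forall i, measurable (A i)) -> (forall i, measurable (B i)) ->
  (forall x, \sum_(i <- r) m2 (xsection (A i) x) <=
             \sum_(i <- r) m2 (xsection (B i) x)) ->
  \sum_(i <- r) (m1 \x m2) (A i) <= \sum_(i <- r) (m1 \x m2) (B i).
Proof.
move=> mA mB AB.
have sumE (C : I -> set (T1 * T2)) : (forall i, measurable (C i)) ->
    \sum_(i <- r) (m1 \x m2) (C i) =
    \int[m1]_x \sum_(i <- r) m2 (xsection (C i) x).
  move=> mC; rewrite ge0_integral_sum// => i.
  exact: measurable_fun_xsection.
rewrite !sumE//; apply: ge0_le_integral => //.
- by move=> x _; apply: sume_ge0.
- by apply: emeasurable_sum => i; exact: measurable_fun_xsection.
- by apply: emeasurable_sum => i; exact: measurable_fun_xsection.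
Qed.

End product_measures.

(** * The law CN(0,1): rotation, scaling and likelihood comparison *)

Section gaussian.
Context {R : realType}.
Local Open Scope ereal_scope.
Notation mu := (@lebesgue_measure R).
Notation RR := (measurableTypeR R * measurableTypeR R)%type.
Let sd : R := Num.sqrt 2^-1.

Let sd0 : sd != 0%R.
Proof. by rewrite gt_eqF// sqrtr_gt0 invr_gt0. Qed.

Lemma CN01_setX (A B : set (measurableTypeR R)) :
  measurable A -> measurable B ->
  CN01 (A `*` B) = half_normal A * half_normal B.
Proof. exact: product_measure1E. Qed.

(** The coordinates are independent with the same symmetric law, so they may be swapped and one of
    them negated. *)
Lemma CN01_rot90 (A : set RR) : measurable A ->
  CN01 ((fun p => (- p.2, p.1)%R) @^-1` A) = CN01 A.
Proof.
move=> mA; rewrite (@product_measure_law _ _ _ _ _ _ _ CN01 half_normal half_normal)//.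
  by apply: measurableT_comp => //; exact: measurable_funN.
move=> B C mB mC.
have -> : (fun p : RR => - p.2)%R @^-1` B `&` fst @^-1` C =
    C `*` ((-%R : measurableTypeR R -> measurableTypeR R) @^-1` B).
  by apply/seteqP; split => -[x y] /= [].
rewrite [LHS]CN01_setX//; last first.
  by rewrite -[X in measurable X]setTI; exact: oppr_measurable.
by rewrite muleC; congr (_ * _); exact: normal_probN.
Qed.

Lemma CN01_scale c (A : set RR) : (0 < c <= 1)%R -> measurable A ->
  CN01 ((fun p => (c * p.1, c * p.2)%R) @^-1` A) <= (c ^- 2)%:E * CN01 A.
Proof.
move=> c01 mA; have /andP[c0 c1] := c01.
have mc : measurable_fun setT
    ((fun x => c * x)%R : measurableTypeR R -> measurableTypeR R).
  by apply: measurable_funM.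
have cV0 : (0 <= c^-1)%R by rewrite invr_ge0 ltW.
have H (B : set (measurableTypeR R)) : measurable B ->
    half_normal ((fun x => c * x)%R @^-1` B) <= c^-1%:E * half_normal B.
  by move=> mB; exact: normal_prob_scale.
(* The two coordinates are scaled one after the other, each costing a factor [c^-1]. *)
set A' := (fun p : RR => (p.1, c * p.2)%R) @^-1` A.
have mA' : measurable A'.
  rewrite -[X in measurable X]setTI.
  have /= := @measurable_fun_pair _ _ _ RR (measurableTypeR R) (measurableTypeR R)
    fst (fun p => c * p.2)%R.
  by apply => //; exact: measurableT_comp.
have := le_product_measure_preimage_l half_normal mc cV0 H mA'.
move=> /le_trans; apply.
rewrite -exprVn expr2 EFinM -muleA lee_pmul2l ?lte_fin ?invr_gt0//.
exact: (le_product_measure_preimage_r half_normal mc cV0 H mA).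
Qed.

Lemma CN01_translate (m : RR) (A : set RR) : measurable A ->
  CN01 ((fun p => (p.1 + m.1, p.2 + m.2)%R) @^-1` A) =
  (normal_prob m.1 sd \x normal_prob m.2 sd) A.
Proof.
move=> mA.
have mt (a : R) : measurable_fun setT
    ((fun x => x + a)%R : measurableTypeR R -> measurableTypeR R).
  by apply: measurable_funD.
rewrite (@product_measure_law _ _ _ _ _ _ _ CN01
  (normal_prob m.1 sd) (normal_prob m.2 sd))//.
- exact: (measurableT_comp (mt m.1)).
- exact: (measurableT_comp (mt m.2)).
move=> B C mB mC.
have -> : (fun p : RR => p.1 + m.1)%R @^-1` B `&`
      (fun p : RR => p.2 + m.2)%R @^-1` C =
    ((fun x : measurableTypeR R => (x + m.1)%R : measurableTypeR R) @^-1` B) `*`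
    ((fun x : measurableTypeR R => (x + m.2)%R : measurableTypeR R) @^-1` C) by [].
rewrite [LHS]CN01_setX; last 2 first.
- by rewrite -[X in measurable X]setTI; exact: mt.
- by rewrite -[X in measurable X]setTI; exact: mt.
by congr (_ * _); exact: normal_prob_translate.
Qed.

Let measurable_pdf a D : measurable_fun D
  (fun x : measurableTypeR R => (normal_pdf a sd x)%:E).
Proof.
apply: measurable_funTS; apply/measurable_EFinP; exact: measurable_normal_pdf.
Qed.

Lemma normal_prob2E (m : RR) (A : set RR) : measurable A ->
  (normal_prob m.1 sd \x normal_prob m.2 sd) A =
  \int[mu]_x (normal_prob m.2 sd (xsection A x) * (normal_pdf m.1 sd x)%:E).
Proof.
move=> mA; rewrite /product_measure1 ge0_integral_normal_prob//.
exact: measurable_fun_xsection.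
Qed.

(** Variance 1/2 per coordinate makes the exponent exactly minus the squared distance. *)
Lemma normal_pdf_sd (a x : R) : normal_pdf a sd x =
  (normal_peak sd * expR (- (x - a) ^+ 2))%R.
Proof.
rewrite normal_pdfE// /normal_fun; congr (_ * expR _)%R.
by rewrite sqr_sqrtr ?invr_ge0// -mulr_natl divff// divr1.
Qed.

(** On [A] the joint density centred at [m'] dominates pointwise the one centred at [m], since it
    decreases with the distance to the centre. *)
Lemma le_CN01_translate (m m' : RR) (A : set RR) : measurable A ->
  (forall y, A y ->
    (y.1 - m'.1) ^+ 2 + (y.2 - m'.2) ^+ 2 <=
    (y.1 - m.1) ^+ 2 + (y.2 - m.2) ^+ 2)%R ->
  CN01 ((fun p => (p.1 + m.1, p.2 + m.2)%R) @^-1` A) <=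
  CN01 ((fun p => (p.1 + m'.1, p.2 + m'.2)%R) @^-1` A).
Proof.
move=> mA H; rewrite (CN01_translate m mA) (CN01_translate m' mA).
rewrite (normal_prob2E m mA) (normal_prob2E m' mA).
have pdfE (n : RR) x : normal_prob n.2 sd (xsection A x) * (normal_pdf n.1 sd x)%:E
    = \int[mu]_(y in xsection A x) (normal_pdf n.1 sd x * normal_pdf n.2 sd y)%:E.
  rewrite muleC /normal_prob; under [RHS]eq_integral do rewrite EFinM.
  rewrite ge0_integralZl//.
  - exact: measurable_xsection.
  - by move=> y _; rewrite lee_fin normal_pdf_ge0.
  - by rewrite lee_fin normal_pdf_ge0.
have mint (n : RR) : measurable_fun setT (fun x : measurableTypeR R =>
    normal_prob n.2 sd (xsection A x) * (normal_pdf n.1 sd x)%:E).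
  by apply: emeasurable_funM => //; exact: measurable_fun_xsection.
apply: ge0_le_integral => //.
- by move=> x _; rewrite mule_ge0// lee_fin normal_pdf_ge0.
move=> x _; rewrite !pdfE; apply: ge0_le_integral.
- exact: measurable_xsection.
- by move=> y _; rewrite lee_fin mulr_ge0// normal_pdf_ge0.
- under eq_fun do rewrite EFinM.
  exact: measurable_funeM.
- under eq_fun do rewrite EFinM.
  exact: measurable_funeM.
move=> y /xsectionP/H/= Hxy; rewrite lee_fin !normal_pdf_sd.
rewrite [leLHS]mulrACA [leRHS]mulrACA -!expRD ler_wpM2l ?mulr_ge0 ?normal_peak_ge0//.
by rewrite ler_expR -!opprD lerN2.
Qed.

End gaussian.

(** * Maximum-likelihood decoding as a nearest-point rule *)

Section decoding.
Context {R : realType}.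
Implicit Types (X : {fset R[i]}) (l : R[i] -> R) (x y g n m z : R[i]).

(** The decision depends only on the order that the likelihood induces on codewords, ties being
    broken by the same enumeration. *)
Lemma eq_ml_decode X l l' :
  (forall x x', (l x <= l x') = (l' x <= l' x')) -> ml_decode X l = ml_decode X l'.
Proof.
move=> ll'; rewrite /ml_decode.
rewrite (@eq_pick _ _ [pred x : X | [forall x' : X, l' (val x') <= l' (val x)]])//.
by move=> x /=; apply: eq_forallb => x'; rewrite ll'.
Qed.

(** A nonempty finite codebook has a maximizer, so the dummy value is not returned. *)
Lemma ml_decodeP X l x : x \in X ->
  ml_decode X l \in X /\ forall x', x' \in X -> l x' <= l (ml_decode X l).
Proof.
move=> xX; rewrite /ml_decode; case: pickP => [u /forallP ul|/=].
  by split=> [|x' x'X]; [exact: valP|exact: (ul [` x'X]%fset)].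
pose u := [arg max_(u > [` xX]%fset) l (val u)]%O.
move/(_ u)/negbT/forallPn => [v /negP[]].
by rewrite /u; case: Order.TotalTheory.arg_maxP => // i _; apply.
Qed.

Lemma sqmodE z : sqmod z = complex.Re z ^+ 2 + complex.Im z ^+ 2.
Proof. by case: z => a b; rewrite /sqmod /= sqr_sqrtr// addr_ge0// sqr_ge0. Qed.

Lemma sqmod_ge0 z : 0 <= sqmod z. Proof. exact: sqr_ge0. Qed.

Lemma sqmod_eq0 z : (sqmod z == 0) = (z == 0).
Proof.
case: z => a b; rewrite sqmodE/= paddr_eq0 ?sqr_ge0// !sqrf_eq0.
by rewrite eq_complex.
Qed.

Lemma sqmodM z w : sqmod (z * w) = sqmod z * sqmod w.
Proof. by case: z w => a b [c d]; rewrite !sqmodE/=; ring. Qed.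

(** The real inner product of the complex plane. *)
Definition cdot z w : R :=
  complex.Re z * complex.Re w + complex.Im z * complex.Im w.

Lemma sqmodD z w : sqmod (z + w) = sqmod z + 2 * cdot z w + sqmod w.
Proof. by case: z w => a b [c d]; rewrite !sqmodE/cdot/=; ring. Qed.

Lemma cdot_suml K (c : 'I_K -> R) (m : 'I_K -> R[i]) z :
  cdot (\sum_k (c k)%:C * m k) z = \sum_k c k * cdot (m k) z.
Proof.
elim/big_ind2: _ => [|_ a _ b <- <-|k _].
- by rewrite /cdot/= !mul0r addr0.
- by case: a b => [? ?] [? ?]; rewrite /cdot/=; ring.
- by case: (m k) => ? ?; rewrite /cdot/=; ring.
Qed.

(* Decoding [x] from [y = g x + noise] for a known gain [g], which is what both
   maximum-likelihood rules amount to. *)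
Definition nearest X g y : R[i] := ml_decode X (fun x => - sqmod (y - g * x)).

(** The variance does not depend on the codeword, so likelihood decreases with distance. It is 1 for
    the intended symbol and [1 + s * sqmod hd] for the interfering one. *)
Lemma ml_decode_cn_pdf X g v y : 0 < v ->
  ml_decode X (fun x => cn_pdf (g * x) v y) = nearest X g y.
Proof.
move=> v0; apply: eq_ml_decode => x x'.
rewrite /cn_pdf ler_pM2r ?invr_gt0 ?mulr_gt0 ?pi_gt0// ler_expR lerN2.
by rewrite ler_pM2r ?invr_gt0// lerN2.
Qed.

Lemma siso_decodeE s X h y : siso_decode s X h y = nearest X (siso_gain s h) y.
Proof. exact: ml_decode_cn_pdf. Qed.

Lemma interference_decodeE alpha s X hd hc y : 0 <= s ->
  interference_decode alpha s X hd hc y = nearest X (cross_gain alpha s hc) y.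
Proof.
by move=> s0; apply: ml_decode_cn_pdf; rewrite ltr_pwDl// mulr_ge0// sqmod_ge0.
Qed.

Lemma nearest_scale X g y (c : R) : 0 < c ->
  nearest X (c%:C * g) (c%:C * y) = nearest X g y.
Proof.
move=> c0; apply: eq_ml_decode => x x'.
rewrite -!mulrA -!mulrBr !sqmodM !lerN2 ler_pM2l//.
by rewrite lt_neqAle sqmod_ge0 eq_sym sqmod_eq0 eq_complex/= negb_and gt_eqF.
Qed.

Lemma nearest_gain0 X y y' : nearest X 0 y = nearest X 0 y'.
Proof. by apply: eq_ml_decode => x x'; rewrite !mul0r !lexx. Qed.

(* The strict inequality leaves room for ties: equality of distances at the
   combined noise forces the gain to vanish. *)
Lemma nearest_convex X g x K (c : 'I_K.+1 -> R) (m : 'I_K.+1 -> R[i]) :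
  x \in X -> (forall k, 0 <= c k) -> \sum_k c k < 1 ->
  (forall k, nearest X g (g * x + m k) = x) ->
  nearest X g (g * x + \sum_k (c k)%:C * m k) = x.
Proof.
move=> xX c0 c1 mx; set n := \sum_k _ .
have [yX ymax] := @ml_decodeP X (fun x' => - sqmod (g * x + n - g * x')) x xX.
rewrite -/(nearest X g (g * x + n)) in yX ymax *.
set y := nearest _ _ _ in yX ymax *.
have [//|yx] := eqVneq y x; exfalso.
pose d := g * x - g * y.
(* Preferring [y] at noise [n] reads [|n + d|^2 <= |n|^2]; correct decoding at [m k] gives the
   reverse inequality. Both are affine in the noise. *)
have dn : 2 * cdot n d + sqmod d <= 0.
  have := ymax _ xX; rewrite lerN2 addrAC -/d (addrC (g * x)) addrK addrC sqmodD.
  by rewrite -addrA gerDl.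
have dm k : 0 <= 2 * cdot (m k) d + sqmod d.
  have [_ /(_ _ yX)] := @ml_decodeP X (fun x' => - sqmod (g * x + m k - g * x')) x xX.
  rewrite -/(nearest X g (g * x + m k)) mx lerN2.
  rewrite (addrC (g * x)) addrK -addrA -/d sqmodD.
  by rewrite -addrA lerDl.
have d0 : d = 0.
  apply/eqP; rewrite -sqmod_eq0 eq_le sqmod_ge0 andbT.
  (* With [C] the sum of the weights, this gives [0 <= 2 <n, d> + C |d|^2 <= (C - 1) |d|^2], and
     [C < 1] forces [d = 0]. *)
  have : 0 <= \sum_k c k * (2 * cdot (m k) d + sqmod d).
    by apply: sumr_ge0 => k _; rewrite mulr_ge0.
  under eq_bigr do rewrite mulrDr mulrCA.
  rewrite big_split/= -mulr_sumr -cdot_suml -/n -mulr_suml.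
  move: dn c1; have := sqmod_ge0 d.
  move: (sqmod d) (cdot n d) (\sum_k c k) => D N C; nra.
have g0 : g = 0.
  apply/eqP; move/eqP: d0; rewrite /d -mulrBr mulf_eq0 => /orP[//|].
  by rewrite subr_eq0 eq_sym (negbTE yx).
(* With zero gain the decision ignores the observation, so it is the one made at noise [m ord0],
   namely [x]. *)
by move/eqP: yx; apply; rewrite /y -(mx ord0) g0; exact: nearest_gain0.
Qed.

End decoding.

(** * Optimality of maximum likelihood over finitely many symbols *)

Section finite_partition.
Context d (T : measurableType d) (R : realType) (I : choiceType).
Local Open Scope ereal_scope.

Lemma sum_measure_preimage (mu : {measure set T -> \bar R}) (X : {fset I})
    (f : T -> I) (A : set T) :
  measurable A -> (forall i, i \in X -> measurable [set y | f y = i]) ->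
  \sum_(i <- X) mu (A `&` [set y | f y = i]) = mu (A `&` [set y | f y \in X]).
Proof.
move=> mA mf; rewrite -measure_fbigsetU; last 2 first.
- by move=> i iX; apply: measurableI => //; exact: mf.
- apply/trivIsetP => i j _ _ /eqP ij; apply/seteqP; split=> // y.
  by move=> [[_ /= fi]] [_ fj]; apply: ij; rewrite -fi -fj.
congr (mu _); rewrite -bigcup_fset; apply/seteqP; split => y /=.
  by move=> [i /= iX [Ay /= ->]].
by move=> [Ay fX]; exists (f y).
Qed.

(* Optimality of the maximum-likelihood rule [g] for equally likely symbols [x],
   [nu x] being the law of the observation when [x] is sent. *)
Lemma max_likelihood_optimal (X : {fset I}) (nu : I -> {measure set T -> \bar R})
    (f g : T -> I) :
  (forall i, i \in X -> measurable [set y | f y = i]) ->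
  (forall i, i \in X -> measurable [set y | g y = i]) ->
  (forall y, g y \in X) ->
  (forall i j A, i \in X -> j \in X -> measurable A ->
    (forall y, A y -> g y = j) -> nu i A <= nu j A) ->
  \sum_(i <- X) nu i [set y | f y = i] <= \sum_(i <- X) nu i [set y | g y = i].
Proof.
move=> mf mg gX nule.
(* Each event [f = i] is cut according to the decision [j] of [g]; on such a piece [nu i] is at most
   [nu j]. *)
have split1 i : i \in X -> nu i [set y | f y = i] =
    \sum_(j <- X) nu i ([set y | f y = i] `&` [set y | g y = j]).
  move=> iX; rewrite sum_measure_preimage//; last exact: mf.
  by congr (nu i _); apply/seteqP; split => y /= => [fy|[]//]; split=> //=.
rewrite big_seq (eq_bigr _ split1) -big_seq.
apply: (@le_trans _ _ (\sum_(i <- X) \sum_(j <- X)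
    nu j ([set y | f y = i] `&` [set y | g y = j]))).
  rewrite big_seq [leRHS]big_seq; apply: lee_sum => i iX.
  rewrite big_seq [leRHS]big_seq; apply: lee_sum => j jX.
  apply: nule => //; last by move=> y [].
  by apply: measurableI; [exact: mf|exact: mg].
(* After the exchange, the pieces measured by [nu j] are disjoint and lie in the event [g = j]. *)
rewrite exchange_big/= big_seq [leRHS]big_seq; apply: lee_sum => j jX.
under eq_bigr do rewrite setIC.
rewrite sum_measure_preimage//; last exact: mg.
apply: le_measure; rewrite ?inE; last by move=> y [].
  apply: measurableI; first exact: mg.
  rewrite (_ : mkset _ = \bigcup_(i in [set` X]) [set y | f y = i]).
    by apply: fin_bigcup_measurable => // i iX; exact: mf.
  by apply/seteqP; split => y /= => [fX|[i iX /= ->]//]; exists (f y).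
exact: mg.
Qed.

End finite_partition.

(** * Measurability of decision events *)

Section measurable_decoders.
Context d (T : measurableType d) (R : realType).
Implicit Types (X : {fset R[i]}) (F G : T -> R[i]).

(** The decision is a function of the finite table of comparisons between likelihoods, and each
    comparison is a measurable event. *)
Lemma measurable_ml_decode X (lik : T -> R[i] -> R) (P : set R[i]) :
  (forall x, measurable_fun setT (lik ^~ x)) ->
  measurable [set w | P (ml_decode X (lik w))].
Proof.
move=> mlik.
pose dec (b : {ffun X * X -> bool}) : R[i] :=
  if [pick x : X | [forall x' : X, b (x', x)]] is Some x then val x else 0.
pose b w := [ffun p : X * X => lik w (val p.1) <= lik w (val p.2)].
have decE w : ml_decode X (lik w) = dec (b w).
  rewrite /ml_decode /dec.
  rewrite (@eq_pick _ _ [pred x : X | [forall x' : X, b w (x', x)]])//.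
  by move=> x /=; apply: eq_forallb => x'; rewrite ffunE.
rewrite (_ : mkset _ = \bigcup_(c in [set c | P (dec c)])
    \bigcap_(p in [set: X * X]) [set w | b w p = c p]).
  apply: fin_bigcup_measurable; first exact: finite_finset.
  move=> c _; apply: fin_bigcap_measurable; first exact: finite_finset.
  move=> p _; under eq_set do rewrite ffunE.
  have := measurable_fun_ler (mlik (val p.1)) (mlik (val p.2)).
  move=> /(_ measurableT [set c p] I); rewrite setTI.
  by apply.
apply/seteqP; split => w /=; rewrite decE.
  by move=> Pw; exists (b w).
by move=> [c /= Pc cw]; rewrite (_ : b w = c)//; apply/ffunP => p; exact: cw.
Qed.

Definition measurable_cfun F :=
  measurable_fun setT (fun w => complex.Re (F w)) /\
  measurable_fun setT (fun w => complex.Im (F w)).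

Lemma measurable_cfun_cst z : measurable_cfun (fun=> z).
Proof. by split; exact: measurable_cst. Qed.

Lemma measurable_cfunD F G : measurable_cfun F -> measurable_cfun G ->
  measurable_cfun (fun w => F w + G w).
Proof.
move=> [F1 F2] [G1 G2]; split.
  rewrite (_ : (fun w => _) = (fun w => complex.Re (F w) + complex.Re (G w))).
    exact: measurable_funD.
  by apply/funext => w; case: (F w) (G w) => ? ? [].
rewrite (_ : (fun w => _) = (fun w => complex.Im (F w) + complex.Im (G w))).
  exact: measurable_funD.
by apply/funext => w; case: (F w) (G w) => ? ? [].
Qed.

Lemma measurable_cfunN F : measurable_cfun F -> measurable_cfun (fun w => - F w).
Proof.
move=> [F1 F2]; split.
  rewrite (_ : (fun w => _) = (fun w => - complex.Re (F w))).
    exact: measurable_funN.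
  by apply/funext => w; case: (F w).
rewrite (_ : (fun w => _) = (fun w => - complex.Im (F w))).
  exact: measurable_funN.
by apply/funext => w; case: (F w).
Qed.

Lemma measurable_cfunB F G : measurable_cfun F -> measurable_cfun G ->
  measurable_cfun (fun w => F w - G w).
Proof. by move=> mF mG; apply: measurable_cfunD => //; exact: measurable_cfunN. Qed.

Lemma measurable_cfunM F G : measurable_cfun F -> measurable_cfun G ->
  measurable_cfun (fun w => F w * G w).
Proof.
move=> [F1 F2] [G1 G2]; split.
  rewrite (_ : (fun w => _) = (fun w => complex.Re (F w) * complex.Re (G w)
    - complex.Im (F w) * complex.Im (G w))).
    by apply: measurable_funB; exact: measurable_funM.
  by apply/funext => w; case: (F w) (G w) => ? ? [].
rewrite (_ : (fun w => _) = (fun w => complex.Re (F w) * complex.Im (G w)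
    + complex.Im (F w) * complex.Re (G w))).
  by apply: measurable_funD; exact: measurable_funM.
by apply/funext => w; case: (F w) (G w) => ? ? [].
Qed.

Lemma measurable_cplx (f : T -> measurableTypeR R * measurableTypeR R) :
  measurable_fun setT f -> measurable_cfun (fun w => cplx (f w)).
Proof.
move=> mf; split; first exact: (measurableT_comp measurable_fst mf).
exact: (measurableT_comp measurable_snd mf).
Qed.

Lemma measurable_nearest X F G (P : set R[i]) :
  measurable_cfun F -> measurable_cfun G ->
  measurable [set w | P (nearest X (F w) (G w))].
Proof.
move=> mF mG.
apply: (@measurable_ml_decode X (fun w x => - sqmod (G w - F w * x))) => x.
have [m1 m2] : measurable_cfun (fun w => G w - F w * x).
  by apply: measurable_cfunB => //; exact: measurable_cfunM.
apply: measurable_funN; under eq_fun do rewrite sqmodE.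
by apply: measurable_funD; exact: measurable_funX.
Qed.

Variables (alpha s : R).

Lemma measurable_siso_decode X F G (P : set R[i]) :
  measurable_cfun F -> measurable_cfun G ->
  measurable [set w | P (siso_decode s X (F w) (G w))].
Proof.
move=> mF mG; under eq_set do rewrite siso_decodeE.
by apply: measurable_nearest => //; exact: measurable_cfunM.
Qed.

Lemma measurable_interference_decode X F F' G (P : set R[i]) : 0 <= s ->
  measurable_cfun F' -> measurable_cfun G ->
  measurable [set w | P (interference_decode alpha s X (F w) (F' w) (G w))].
Proof.
move=> s0 mF mG; under eq_set do rewrite interference_decodeE//.
by apply: measurable_nearest => //; exact: measurable_cfunM.
Qed.

Lemma measurable_stripping_decode Xi Xj F F' G (P : set R[i]) : 0 <= s ->
  measurable_cfun F -> measurable_cfun F' -> measurable_cfun G ->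
  measurable [set w | P (stripping_decode alpha s Xi Xj (F w) (F' w) (G w))].
Proof.
move=> s0 mF mF' mG.
pose v w := interference_decode alpha s Xj (F w) (F' w) (G w).
(* The event is split by the outcome [u] of the first stage; 0 is added because it is the outcome
   for an empty codebook. *)
rewrite (_ : mkset _ = \bigcup_(u in [set` (0 |` Xj)%fset])
   ([set w | v w = u] `&` [set w | P (siso_decode s Xi (F w)
      (G w - cross_gain alpha s (F' w) * u))])).
  apply: fin_bigcup_measurable => // u _; apply: measurableI.
    exact: (@measurable_interference_decode _ _ _ _ [set u]).
  apply: measurable_siso_decode => //; apply: measurable_cfunB => //.
  apply: measurable_cfunM; last exact: measurable_cfun_cst.
  exact: measurable_cfunM.
apply/seteqP; split => w /=; last by move=> [u /= _ [/= <-]].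
move=> Pw; exists (v w) => //=.
rewrite !inE /v /interference_decode /ml_decode; case: pickP => [x _|_].
  by rewrite (valP x) orbT.
by rewrite eqxx.
Qed.

End measurable_decoders.

(** * Decision errors in Gaussian noise, and marginals of fading and noise *)

Section error_probabilities.
Context {R : realType}.
Local Notation RR := (measurableTypeR R * measurableTypeR R)%type.
Local Notation P2 := (CN01 \x CN01)%E.
Local Notation P3 := ((CN01 \x CN01) \x CN01)%E.
Implicit Types (X Xi Xj : {fset R[i]}) (alpha s : R) (p hd hc z : RR).

Definition translate g p : RR := (p.1 + complex.Re g, p.2 + complex.Im g).

Lemma cplx_translate g p : cplx (translate g p) = g + cplx p.
Proof. by rewrite /cplx; case: g => a b /=; rewrite addrC (addrC p.2). Qed.

Lemma measurable_translate g : measurable_fun setT (translate g).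
Proof.
have madd (a : R) : measurable_fun setT
    ((fun x => x + a) : measurableTypeR R -> measurableTypeR R).
  by apply: measurable_funD.
apply: measurable_fun_pair; first exact: (measurableT_comp (madd _)).
exact: (measurableT_comp (madd _)).
Qed.

Definition decision_event (D : RR -> R[i]) (x : R[i]) : set RR := [set p | D p = x].

Lemma CN01_nearest_optimal X g x0 (D : RR -> R[i]) : x0 \in X ->
  (forall x, measurable (decision_event D x)) ->
  (\sum_(x <- X) CN01 (~` (translate (g * x)%R @^-1`
     decision_event (fun p => nearest X g (cplx p)) x)) <=
   \sum_(x <- X) CN01 (~` (translate (g * x)%R @^-1` decision_event D x)))%E.
Proof.
move=> x0X mD.
(* [nu x] is the law of the observation when [x] is sent over gain [g]. *)
have /choice[nu nuE] x : exists nu : {measure set RR -> \bar R},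
    forall A, nu A = CN01 (translate (g * x) @^-1` A).
  have [nu nuE] := pushforward_measure CN01 (measurable_translate (g * x)).
  by exists nu.
set N := fun p => nearest X g (cplx p).
have mN x : measurable (decision_event N x).
  apply: (@measurable_nearest _ _ _ _ _ _ [set x]); first exact: measurable_cfun_cst.
  exact: measurable_cplx.
have H : (\sum_(x <- X) nu x (decision_event D x) <=
          \sum_(x <- X) nu x (decision_event N x))%E.
  apply: (@max_likelihood_optimal _ _ _ _ X nu D N).
  - by move=> x _; exact: mD.
  - by move=> x _; exact: mN.
    by move=> p; have [] := @ml_decodeP _ X (fun x => - sqmod (cplx p - g * x)) _ x0X.
  move=> x x' A xX x'X mA AN; rewrite !nuE.
  apply: (@le_CN01_translate _ (_, _) (_, _)) => // p Ap /=.
  have [_ /(_ _ xX)] := @ml_decodeP _ X (fun x => - sqmod (cplx p - g * x)) _ x0X.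
  rewrite -/(nearest X g (cplx p)) -/(N p) (AN _ Ap) lerN2 !sqmodE /cplx.
  by case: (g * x) (g * x') => ? ? [].
(* Comparing errors amounts to comparing successes [H]; passing to real numbers makes the
   subtraction from 1 legitimate. *)
have errE F x : (forall x, measurable (decision_event F x)) ->
    CN01 (~` (translate (g * x) @^-1` decision_event F x)) =
    (1 - fine (nu x (decision_event F x)))%:E.
  move=> mF.
  have mpre : measurable (translate (g * x) @^-1` decision_event F x).
    by rewrite -[X in measurable X]setTI; exact: measurable_translate.
  by rewrite nuE EFinB fineK ?fin_num_measure// probability_setC.
have finE F x : (forall x, measurable (decision_event F x)) ->
    nu x (decision_event F x) = (fine (nu x (decision_event F x)))%:E.
  move=> mF; rewrite fineK// nuE fin_num_measure//.
  by rewrite -[X in measurable X]setTI; exact: measurable_translate.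
rewrite (eq_bigr _ (fun x _ => errE N x mN)).
rewrite [leRHS](eq_bigr _ (fun x _ => errE D x mD)).
move: H; rewrite (eq_bigr _ (fun x _ => finE D x mD)).
rewrite [leRHS](eq_bigr _ (fun x _ => finE N x mN)).
by rewrite !sumEFin !lee_fin !sumrB lerD2l lerN2.
Qed.

Lemma CN01_setX3 (A B C : set RR) : measurable A -> measurable B -> measurable C ->
  (P3 ((A `*` B) `*` C) = CN01 A * CN01 B * CN01 C)%E.
Proof.
move=> mA mB mC; have mAB : measurable (A `*` B) by exact: measurableX.
apply: etrans (product_measure1E P2 CN01 mAB mC) _; congr (_ * _)%E.
exact: product_measure1E.
Qed.

(** The coordinate projected out has total mass 1. Two distinct coordinates of the triple of direct
    fading, cross fading and noise thus have the law of a SISO fading and noise. *)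
Lemma CN01_law13 (A : set (RR * RR)) : measurable A ->
  P3 [set w : RR * RR * RR | A (w.1.1, w.2)] = P2 A.
Proof.
apply: (@product_measure_law _ _ _ _ _ _ _ P3 CN01 CN01 (fst \o fst) snd) => //.
  exact: measurableT_comp.
move=> B C mB mC.
have -> : (fst \o fst) @^-1` B `&` snd @^-1` C =
    (B `*` setT) `*` C :> set (RR * RR * RR).
  by apply/seteqP; split => w /=; [move=> []|move=> [[]]].
by apply: etrans (CN01_setX3 _ _ _) _ => //; rewrite probability_setT mule1.
Qed.

Lemma CN01_law23 (A : set (RR * RR)) : measurable A ->
  P3 [set w : RR * RR * RR | A (w.1.2, w.2)] = P2 A.
Proof.
apply: (@product_measure_law _ _ _ _ _ _ _ P3 CN01 CN01 (snd \o fst) snd) => //.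
  exact: measurableT_comp.
move=> B C mB mC.
have -> : (snd \o fst) @^-1` B `&` snd @^-1` C =
    (setT `*` B) `*` C :> set (RR * RR * RR).
  by apply/seteqP; split => w /=; [move=> []|move=> [[]]].
by apply: etrans (CN01_setX3 _ _ _) _ => //; rewrite probability_setT mul1e.
Qed.

(** Here the cross coefficient stands for the SISO fading and the direct coefficient for the SISO
    noise. *)
Lemma CN01_law21 (A : set (RR * RR)) : measurable A ->
  P3 [set w : RR * RR * RR | A (w.1.2, w.1.1)] = P2 A.
Proof.
apply: (@product_measure_law _ _ _ _ _ _ _ P3 CN01 CN01 (snd \o fst) (fst \o fst)).
- exact: measurableT_comp.
- exact: measurableT_comp.
move=> B C mB mC.
have -> : (snd \o fst) @^-1` B `&` (fst \o fst) @^-1` C =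
    (C `*` B) `*` setT :> set (RR * RR * RR).
  by apply/seteqP; split => w /=; [move=> []|move=> [[]]].
apply: etrans (CN01_setX3 mC mB measurableT) _.
by rewrite (@probability_setT _ _ _ CN01) mule1; exact: muleC.
Qed.

End error_probabilities.

Lemma probability_fineK d (T : measurableType d) (R : realType)
    (P : probability T R) (A : set T) : measurable A -> P A = (fine (P A))%:E.
Proof. by move=> mA; rewrite fineK// fin_num_measure. Qed.

(** * Lower bound by the SISO error probability *)

Section stripping_error_lower_bound.
Context {R : realType}.
Local Notation RR := (measurableTypeR R * measurableTypeR R)%type.
Local Notation P2 := (CN01 \x CN01)%E.
Local Notation P3 := ((CN01 \x CN01) \x CN01)%E.
Implicit Types (X Xi Xj : {fset R[i]}) (alpha s : R) (p hd hc z : RR).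

Definition siso_error_event s X x : set (RR * RR) :=
  [set w | siso_decode s X (cplx w.1) (siso_output s (cplx w.1) x (cplx w.2)) != x].

Definition stripping_error_event alpha s Xi Xj xi xj : set (RR * RR * RR) :=
  [set w | stripping_decode alpha s Xi Xj (cplx w.1.1) (cplx w.1.2)
    (ic_output alpha s (cplx w.1.1) (cplx w.1.2) xi xj (cplx w.2)) != xi].

Lemma measurable_siso_error_event s X x : measurable (siso_error_event s X x).
Proof.
apply: (@measurable_siso_decode _ _ _ _ _ _ _ (fun v => v != x)).
  by apply: measurable_cplx.
apply: measurable_cfunD; last by apply: measurable_cplx.
apply: measurable_cfunM; last exact: measurable_cfun_cst.
apply: measurable_cfunM; first exact: measurable_cfun_cst.
by apply: measurable_cplx.
Qed.

Lemma measurable_ic_output d (T : measurableType d) alpha s xi xj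
    (hd hc z : T -> RR) :
  measurable_fun setT hd -> measurable_fun setT hc -> measurable_fun setT z ->
  measurable_cfun (fun w =>
    ic_output alpha s (cplx (hd w)) (cplx (hc w)) xi xj (cplx (z w))).
Proof.
move=> mhd mhc mz; apply: measurable_cfunD; last exact: measurable_cplx.
by apply: measurable_cfunD; apply: measurable_cfunM => //;
  try exact: measurable_cfun_cst;
  apply: measurable_cfunM => //; try exact: measurable_cfun_cst;
  exact: measurable_cplx.
Qed.

Let mw11 : measurable_fun setT (fun w : RR * RR * RR => w.1.1).
Proof. exact: (measurableT_comp measurable_fst measurable_fst). Qed.

Let mw12 : measurable_fun setT (fun w : RR * RR * RR => w.1.2).
Proof. exact: (measurableT_comp measurable_snd measurable_fst). Qed.

Lemma measurable_stripping_error_event alpha s Xi Xj xi xj : 0 <= s ->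
  measurable (stripping_error_event alpha s Xi Xj xi xj).
Proof.
move=> s0.
apply: (@measurable_stripping_decode _ _ _ _ _ _ _ _ _ _ (fun v => v != xi)) => //.
- exact: measurable_cplx.
- exact: measurable_cplx.
- exact: measurable_ic_output.
Qed.

(* Even a receiver that is told the interfering symbol cannot beat the
   maximum-likelihood decoder of the interference-free channel. *)
Lemma sum_siso_le_stripping alpha s Xi Xj xj : 0 <= s ->
  (\sum_(xi <- Xi) P2 (siso_error_event s Xi xi) <=
   \sum_(xi <- Xi) P3 (stripping_error_event alpha s Xi Xj xi xj))%E.
Proof.
move=> s0; have [->|[x0 x0X]] := fset_0Vmem Xi; first by rewrite !big_seq_fset0.
have mS x : measurable [set w : RR * RR * RR | siso_error_event s Xi x (w.1.1, w.2)].
  have mf : measurable_fun setT (fun w : RR * RR * RR => (w.1.1, w.2)).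
    exact: measurable_fun_pair.
  rewrite -[X in measurable X]setTI.
  exact: (mf measurableT _ (measurable_siso_error_event s Xi x)).
have mT x := measurable_stripping_error_event alpha Xi Xj x xj s0.
(* The SISO event is lifted to the space of triples, so that both sides can be compared for the same
   fading coefficients. *)
rewrite (eq_bigr (fun x =>
  P3 [set w : RR * RR * RR | siso_error_event s Xi x (w.1.1, w.2)])); last first.
  by move=> x _; rewrite CN01_law13//; exact: measurable_siso_error_event.
apply: (le_sum_product_measure _ mS mT) => -[hd hc].
set g := siso_gain s (cplx hd); set b := cross_gain alpha s (cplx hc) * xj.
(* Given the interference [b], a SISO receiver can add it back to its observation and run the
   stripping decoder; this defines a competitor to maximum likelihood. *)
pose D (p : RR) := stripping_decode alpha s Xi Xj (cplx hd) (cplx hc) (cplx p + b).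
have mD x : measurable (decision_event D x).
  apply: (@measurable_stripping_decode _ RR R alpha s Xi Xj
    (fun=> cplx hd) (fun=> cplx hc) (fun p => cplx p + b) [set x] s0).
  - exact: measurable_cfun_cst.
  - exact: measurable_cfun_cst.
  - apply: measurable_cfunD; last exact: measurable_cfun_cst.
    exact: measurable_cplx.
have e1 x : xsection
    [set w : RR * RR * RR | siso_error_event s Xi x (w.1.1, w.2)] (hd, hc)
    = ~` (translate (g * x) @^-1` decision_event (fun p => nearest Xi g (cplx p)) x).
  apply/seteqP; split => z;
    rewrite /xsection/= inE /siso_error_event /decision_event/= cplx_translate;
    by rewrite siso_decodeE => /eqP.
have e2 x : xsection (stripping_error_event alpha s Xi Xj x xj) (hd, hc)
    = ~` (translate (g * x) @^-1` decision_event D x).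
  apply/seteqP; split => z;
    rewrite /xsection/= inE /stripping_error_event /decision_event /D/= cplx_translate;
    by rewrite /ic_output -/g -/b addrAC => /eqP.
apply: le_trans (le_trans _ (CN01_nearest_optimal g x0X mD)) _.
  by apply: lee_sum => x _; rewrite -e1.
by apply: lee_sum => x _; rewrite -e2.
Qed.

Lemma siso_errorE s X : siso_error s X =
  (#|` X|)%:R^-1 * \sum_(x <- X) fine (P2 (siso_error_event s X x)).
Proof. by []. Qed.

Lemma stripping_errorE alpha s Xi Xj : stripping_error alpha s Xi Xj =
  (#|` Xi| * #|` Xj|)%N%:R^-1 * \sum_(xi <- Xi) \sum_(xj <- Xj)
    fine (P3 (stripping_error_event alpha s Xi Xj xi xj)).
Proof. by []. Qed.

Lemma siso_event_fin s X x :
  P2 (siso_error_event s X x) = (fine (P2 (siso_error_event s X x)))%:E.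
Proof.
apply: (@probability_fineK _ _ _ (CN01 \x CN01)%E).
exact: measurable_siso_error_event.
Qed.

Lemma stripping_event_fin alpha s Xi Xj xi xj : 0 <= s ->
  P3 (stripping_error_event alpha s Xi Xj xi xj) =
  (fine (P3 (stripping_error_event alpha s Xi Xj xi xj)))%:E.
Proof.
move=> s0; apply: (@probability_fineK _ _ _ ((CN01 \x CN01) \x CN01)%E).
exact: measurable_stripping_error_event.
Qed.

Lemma sumr_const_fset X (c : R) : \sum_(x <- X) c = (#|` X|)%:R * c.
Proof. by rewrite big_const_seq count_predT iter_addr_0 mulr_natl. Qed.

(** The bound for fixed [xj] is averaged over [Xj]. For an empty [Xj] the stripping error would be
    0, as [0^-1 = 0]. *)
Lemma siso_error_le_stripping_error alpha s Xi Xj : 0 <= s ->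
  Xj != fset0 -> siso_error s Xi <= stripping_error alpha s Xi Xj.
Proof.
move=> s0 Xj0; rewrite siso_errorE stripping_errorE natrM invfM -mulrA.
rewrite ler_wpM2l// exchange_big/=.
have nj0 : (0 : R) < (#|` Xj|)%:R by rewrite ltr0n cardfs_gt0.
rewrite ler_pdivlMl// -sumr_const_fset; apply: ler_sum => xj _.
have := sum_siso_le_stripping alpha Xi Xj xj s0.
rewrite (eq_bigr _ (fun x _ => siso_event_fin s Xi x)).
rewrite [leRHS](eq_bigr _ (fun x _ => stripping_event_fin alpha Xi Xj x xj s0)).
by rewrite !sumEFin lee_fin.
Qed.

End stripping_error_lower_bound.

(** * Upper bound by the SISO error probabilities of both users *)

Section stripping_error_upper_bound.
Context {R : realType}.
Local Notation RR := (measurableTypeR R * measurableTypeR R)%type.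
Local Notation P2 := (CN01 \x CN01)%E.
Local Notation P3 := ((CN01 \x CN01) \x CN01)%E.
Implicit Types (X Xi Xj : {fset R[i]}) (alpha s : R) (p hd hc z : RR).

(* Multiplication by ['i]. *)
Definition rot90 p : RR := (- p.2, p.1).

(** The factor 4 brings each of the three noise weights to at most 1/4, so that their sum stays
    below 1 as [nearest_convex] requires. *)
Definition quarter p : RR := (4^-1 * p.1, 4^-1 * p.2).

Lemma cross_gainE alpha s hc : 0 < s ->
  siso_gain s (cplx (quarter hc)) =
  (Num.sqrt s / (4 * Num.sqrt (s `^ alpha)))%:C * cross_gain alpha s (cplx hc).
Proof.
move=> s0; have sa0 : Num.sqrt (s `^ alpha) != 0.
  by rewrite gt_eqF// sqrtr_gt0 powR_gt0.
rewrite /siso_gain /cross_gain /cplx /quarter/= mulrA.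
apply/eqP; rewrite eq_complex/=; apply/andP; split; apply/eqP; field; exact: sa0.
Qed.

(* Writing [xi = a + b i], the noise [sqrt s * hd * xi + z] at the first stage is a
   nonnegative combination of [z], [+/- hd] and [+/- i hd]. *)
Lemma interference_error_siso alpha s Xj xi xj hd hc z :
  1 <= s -> 2 <= alpha -> sqmod xi <= 1 -> xj \in Xj ->
  interference_decode alpha s Xj (cplx hd) (cplx hc)
    (ic_output alpha s (cplx hd) (cplx hc) xi xj (cplx z)) != xj ->
  [\/ siso_error_event s Xj xj (quarter hc, z),
      siso_error_event s Xj xj
        (quarter hc, iter (if 0 <= complex.Re xi then 0 else 2) rot90 hd) |
      siso_error_event s Xj xj
        (quarter hc, iter (if 0 <= complex.Im xi then 1 else 3) rot90 hd)].
Proof.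
move=> s1 al2 xi1 xjX; have s0 : 0 < s by exact: lt_le_trans s1.
set nR := (X in iter X _ hd); set nI := (X in [\/ _, _ | _ (_, iter X _ hd)]).
set S := Num.sqrt s; set T := Num.sqrt (s `^ alpha).
have S1 : 1 <= S by rewrite -sqrtr1 ler_sqrt// ltW.
have T0 : 0 < T by rewrite sqrtr_gt0 powR_gt0.
(* Here [alpha >= 2] enters: [s ^ 2 <= s ^ alpha], so the interference gain [T] dominates [s]. *)
have sT : s <= T.
  rewrite -[leLHS]gtr0_norm// -sqrtr_sqr ler_sqrt ?powR_ge0//.
  by rewrite -powR_mulrn ?(ltW s0)//; exact: ler_powR.
have SS : S * S = s by rewrite -expr2 sqr_sqrtr// ltW.
pose t := S / (4 * T).
have t0 : 0 < t by rewrite divr_gt0 ?mulr_gt0// (lt_le_trans _ S1).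
have tS : t * S <= 4^-1.
  rewrite /t mulrAC SS ler_pdivrMr ?mulr_gt0// mulrA mulVf// mul1r.
  exact: sT.
have tle : t <= 4^-1 by apply: le_trans tS; rewrite ler_peMr// ltW.
move: xi1; rewrite sqmodE => xi1.
have norm_le1 (x y : R) : x ^+ 2 + y ^+ 2 <= 1 -> `|x| <= 1.
  by move=> xy; rewrite ler_norml; apply/andP; split; nra.
have a1 : `|complex.Re xi| <= 1 by exact: norm_le1 xi1.
have b1 : `|complex.Im xi| <= 1 by move: xi1; rewrite addrC => /norm_le1.
pose c (k : 'I_3) : R :=
  nth 0 [:: t; t * S * `|complex.Re xi|; t * S * `|complex.Im xi|] k.
pose m (k : 'I_3) : RR := nth z [:: z; iter nR rot90 hd; iter nI rot90 hd] k.
(* If any of the three noises causes a SISO error, the claim holds. Otherwise all three are decoded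
   correctly and convexity contradicts the assumed error. *)
have [E0|/negP/negPn/eqP E0] := pselect (siso_error_event s Xj xj (quarter hc, z)).
  by move=> _; constructor 1.
have [E1|/negP/negPn/eqP E1] :=
    pselect (siso_error_event s Xj xj (quarter hc, iter nR rot90 hd)).
  by move=> _; constructor 2.
have [E2|/negP/negPn/eqP E2] :=
    pselect (siso_error_event s Xj xj (quarter hc, iter nI rot90 hd)).
  by move=> _; constructor 3.
move=> /eqP err; exfalso; apply: err.
rewrite interference_decodeE ?(ltW s0)//.
rewrite -(nearest_scale _ _ _ t0) -cross_gainE//.
have -> : t%:C * ic_output alpha s (cplx hd) (cplx hc) xi xj (cplx z) =
    siso_gain s (cplx (quarter hc)) * xj + \sum_k (c k)%:C * cplx (m k).
  rewrite (cross_gainE alpha)// -/T -/S -/t /ic_output /siso_gain -/S.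
  rewrite !big_ord_recl big_ord0 addr0 /c /m/=.
  (* The sign of a coefficient is carried by the noise, to keep the weights nonnegative: two quarter
     turns give [- hd], and below one or three give ['i * hd] or its opposite. *)
  have -> : (t * S * `|complex.Re xi|)%:C * cplx (iter nR rot90 hd) =
      (t * S * complex.Re xi)%:C * cplx hd.
    rewrite /nR /cplx; case: ifPn => [x0|]; first by rewrite ger0_norm.
    rewrite -ltNge => x0; rewrite ltr0_norm//=.
    by apply/eqP; rewrite eq_complex/=; apply/andP; split; apply/eqP; ring.
  have -> : (t * S * `|complex.Im xi|)%:C * cplx (iter nI rot90 hd) =
      (t * S * complex.Im xi)%:C * ('i * cplx hd).
    rewrite /nI /cplx; case: ifPn => [x0|].
      rewrite ger0_norm//=.
      by apply/eqP; rewrite eq_complex/=; apply/andP; split; apply/eqP; ring.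
    rewrite -ltNge => x0; rewrite ltr0_norm//=.
    by apply/eqP; rewrite eq_complex/=; apply/andP; split; apply/eqP; ring.
  case: xi {xi1 a1 b1 nR nI c m E1 E2} => a b /=; rewrite /cplx.
  move: (cross_gain _ _ _) xj {xjX E0} => [g1 g2] [x1 x2].
  by apply/eqP; rewrite eq_complex/=; apply/andP; split; apply/eqP; ring.
apply: nearest_convex => //.
- have tS0 : 0 <= t * S by rewrite mulr_ge0 ?sqrtr_ge0// ltW.
  case=> -[|[|[|//]]] ?; rewrite /c/=; first exact: ltW.
    exact: mulr_ge0.
  exact: mulr_ge0.
- rewrite !big_ord_recl big_ord0 /c/=.
  have le4 (x : R) : `|x| <= 1 -> t * S * `|x| <= 4^-1.
    by move=> x1; rewrite -[leRHS]mulr1 ler_pM// mulr_ge0 ?sqrtr_ge0// ltW.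
  have := le4 _ a1; have := le4 _ b1; rewrite -/t.
  move: (t * S * `|complex.Re xi|) (t * S * `|complex.Im xi|) => u v hv hu.
  by move: tle hu hv; rewrite /=; lra.
- case=> -[|[|[|//]]] ?; rewrite /m/= -siso_decodeE.
  + exact: E0.
  + exact: E1.
  + exact: E2.
Qed.

Lemma CN01_rot90_iter n (A : set RR) : measurable A ->
  CN01 (iter n rot90 @^-1` A) = CN01 A.
Proof.
have mrot : measurable_fun setT rot90.
  apply: measurable_fun_pair; last exact: measurable_fst.
  exact: measurableT_comp measurable_snd.
elim: n A => [//|n IH A mA].
transitivity (CN01 (rot90 @^-1` A)); last exact: CN01_rot90.
apply: (IH (rot90 @^-1` A)).
by rewrite -[X in measurable X]setTI; exact: mrot.
Qed.

Lemma measurable_rot90_iter n : measurable_fun setT (iter n rot90).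
Proof.
have mN : measurable_fun setT (-%R : measurableTypeR R -> measurableTypeR R).
  exact: oppr_measurable.
elim: n => [|n IH]; first exact: measurable_id.
apply: measurable_fun_pair; last exact: (measurableT_comp measurable_fst IH).
exact: (measurableT_comp mN (measurableT_comp measurable_snd IH)).
Qed.

Lemma measurable_quarter : measurable_fun setT quarter.
Proof.
have m4 : measurable_fun setT
    ((fun x => 4^-1 * x) : measurableTypeR R -> measurableTypeR R).
  by apply: measurable_funM.
apply: measurable_fun_pair; first exact: (measurableT_comp m4 measurable_fst).
exact: (measurableT_comp m4 measurable_snd).
Qed.

(** The constant 16 is [4 ^ 2]: a factor 4 for each real coordinate of the fading. *)
Lemma CN01_quarter (A : set (RR * RR)) : measurable A ->
  (P2 ((fun w => (quarter w.1, w.2)) @^-1` A) <= 16%:R%:E * P2 A)%E.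
Proof.
apply: le_product_measure_preimage_l => //; first exact: measurable_quarter.
move=> B mB; have /CN01_scale/(_ mB) : 0 < (4^-1 : R) <= 1 by lra.
by rewrite exprVn invrK -natrX.
Qed.

Lemma P3_quarter_noise (A : set (RR * RR)) : measurable A ->
  (P3 [set w : RR * RR * RR | A (quarter w.1.2, w.2)] <= 16%:R%:E * P2 A)%E.
Proof.
move=> mA; pose B := (fun w : RR * RR => (quarter w.1, w.2)) @^-1` A.
have mB : measurable B.
  have ms : measurable_fun setT (fun w : RR * RR => quarter w.1).
    exact: (measurableT_comp measurable_quarter measurable_fst).
  exact: (measurable_pair_preimage ms measurable_snd mA).
by have := CN01_law23 mB; rewrite /B/= => ->; exact: CN01_quarter.
Qed.

Lemma P3_quarter_rot90 n (A : set (RR * RR)) : measurable A ->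
  (P3 [set w : RR * RR * RR | A (quarter w.1.2, iter n rot90 w.1.1)] <=
   16%:R%:E * P2 A)%E.
Proof.
move=> mA; pose B := (fun w : RR * RR => (w.1, iter n rot90 w.2)) @^-1` A.
have mB : measurable B.
  have mr : measurable_fun setT (fun w : RR * RR => iter n rot90 w.2).
    exact: (measurableT_comp (measurable_rot90_iter n) measurable_snd).
  exact: (measurable_pair_preimage measurable_fst mr mA).
pose C := (fun w : RR * RR => (quarter w.1, w.2)) @^-1` B.
have mC : measurable C.
  have ms : measurable_fun setT (fun w : RR * RR => quarter w.1).
    exact: (measurableT_comp measurable_quarter measurable_fst).
  exact: (measurable_pair_preimage ms measurable_snd mB).
have := CN01_law21 mC; rewrite /C/B/= => ->.
apply: le_trans (CN01_quarter mB) _.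
apply: lee_wpmul2l; first by rewrite lee_fin.
have H (D : set RR) : measurable D ->
    (CN01 (iter n rot90 @^-1` D) <= 1%:E * CN01 D)%E.
  by move=> mD; rewrite mul1e CN01_rot90_iter.
rewrite -[leRHS]mul1e.
exact: (le_product_measure_preimage_r CN01 (measurable_rot90_iter n) ler01 H mA).
Qed.

(** If the first stage is correct, the second sees exactly a SISO channel. Otherwise one of three
    SISO errors for [xj] occurs, each costing the factor 16; hence [48 = 3 * 16]. *)
Lemma stripping_event_le alpha s Xi Xj xi xj :
  1 <= s -> 2 <= alpha -> sqmod xi <= 1 -> xj \in Xj ->
  (P3 (stripping_error_event alpha s Xi Xj xi xj) <=
   P2 (siso_error_event s Xi xi) + 48%:R%:E * P2 (siso_error_event s Xj xj))%E.
Proof.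
move=> s1 al2 xi1 xjX; have s0 : 0 <= s by exact: le_trans s1.
set E := siso_error_event s Xj xj.
have mE : measurable E by exact: measurable_siso_error_event.
have mEi : measurable (siso_error_event s Xi xi).
  exact: measurable_siso_error_event.
pose nR := if 0 <= complex.Re xi then 0%N else 2%N.
pose nI := if 0 <= complex.Im xi then 1%N else 3%N.
pose A0 := [set w : RR * RR * RR | siso_error_event s Xi xi (w.1.1, w.2)].
pose A1 := [set w : RR * RR * RR | E (quarter w.1.2, w.2)].
pose A2 n := [set w : RR * RR * RR | E (quarter w.1.2, iter n rot90 w.1.1)].
have m11 : measurable_fun setT (fun w : RR * RR * RR => w.1.1).
  exact: (measurableT_comp measurable_fst measurable_fst).
have m12 : measurable_fun setT (fun w : RR * RR * RR => quarter w.1.2).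
  apply: (measurableT_comp measurable_quarter).
  exact: (measurableT_comp measurable_snd measurable_fst).
have mA0 : measurable A0 by exact: (measurable_pair_preimage m11 measurable_snd mEi).
have mA1 : measurable A1 by exact: (measurable_pair_preimage m12 measurable_snd mE).
have mA2 n : measurable (A2 n).
  have mr : measurable_fun setT (fun w : RR * RR * RR => iter n rot90 w.1.1).
    exact: (measurableT_comp (measurable_rot90_iter n) m11).
  exact: (measurable_pair_preimage m12 mr mE).
have m22 := measurableU _ _ (mA2 nR) (mA2 nI).
have m122 := measurableU _ _ mA1 m22.
have m0122 := measurableU _ _ mA0 m122.
apply: (@le_trans _ _ (P3 (A0 `|` (A1 `|` (A2 nR `|` A2 nI))))).
  apply: le_measure; rewrite ?inE.
  - exact: measurable_stripping_error_event.
  - exact: m0122.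
  move=> -[[hd hc] z]; rewrite /stripping_error_event/= /stripping_decode/= => err.
  have [E0|E0] := eqVneq (interference_decode alpha s Xj (cplx hd) (cplx hc)
      (ic_output alpha s (cplx hd) (cplx hc) xi xj (cplx z))) xj.
    by left; move: err; rewrite E0 /ic_output addrAC addrK.
  by right; have [] := interference_error_siso s1 al2 xi1 xjX E0;
    [left|right; left|right; right].
have leU (B C : set (RR * RR * RR)) b c : measurable B -> measurable C ->
    (P3 B <= b)%E -> (P3 C <= c)%E -> (P3 (B `|` C) <= b + c)%E.
  by move=> mB mC Bb Cc; apply: le_trans (leeD Bb Cc); exact: measureU2.
apply: (leU _ _ _ _ mA0 m122).
  by rewrite le_eqVlt; apply/orP; left; apply/eqP; exact: CN01_law13.
have -> : (48%:R%:E * P2 E =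
    16%:R%:E * P2 E + (16%:R%:E * P2 E + 16%:R%:E * P2 E))%E.
  rewrite /E siso_event_fin -!EFinM -!EFinD.
  by congr EFin; rewrite -!mulrDl -!natrD.
apply: (leU _ _ _ _ mA1 m22); first exact: P3_quarter_noise.
by apply: (leU _ _ _ _ (mA2 nR) (mA2 nI)); exact: P3_quarter_rot90.
Qed.

Lemma stripping_error_le alpha s Xi Xj :
  1 <= s -> 2 <= alpha -> Xi != fset0 -> Xj != fset0 ->
  (forall x, x \in Xi -> sqmod x <= 1) ->
  stripping_error alpha s Xi Xj <= siso_error s Xi + 48 * siso_error s Xj.
Proof.
move=> s1 al2 Xi0 Xj0 Xi1; have s0 : 0 <= s by exact: le_trans s1.
rewrite !siso_errorE stripping_errorE natrM.
have ni0 : (0 : R) < (#|` Xi|)%:R by rewrite ltr0n cardfs_gt0.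
have nj0 : (0 : R) < (#|` Xj|)%:R by rewrite ltr0n cardfs_gt0.
rewrite ler_pdivrMl ?mulr_gt0//.
set e := fun x => fine (P2 (siso_error_event s Xi x)).
set f := fun x => fine (P2 (siso_error_event s Xj x)).
apply: (@le_trans _ _ (\sum_(xi <- Xi) \sum_(xj <- Xj) (e xi + 48 * f xj))).
  rewrite big_seq [leRHS]big_seq; apply: ler_sum => xi xiX.
  rewrite big_seq [leRHS]big_seq; apply: ler_sum => xj xjX.
  have := stripping_event_le Xi s1 al2 (Xi1 _ xiX) xjX.
  rewrite (stripping_event_fin alpha Xi Xj xi xj s0) (siso_event_fin s Xi).
  by rewrite (siso_event_fin s Xj) -EFinM -EFinD lee_fin.
rewrite le_eqVlt; apply/orP; left; apply/eqP.
under eq_bigr do rewrite big_split/= sumr_const_fset -mulr_sumr.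
rewrite big_split/= sumr_const_fset -mulr_sumr.
move: ni0 nj0; move: (#|` Xi|%:R) (#|` Xj|%:R) => ni nj ni0 nj0.
move: (\sum_(x <- Xi) e x) (\sum_(x <- Xj) f x) => a b.
by field; rewrite !gt_eqF.
Qed.

End stripping_error_upper_bound.

(** * Exponents of functions of the SNR *)

Section exponents.
Context {R : realType}.
Implicit Types (f g h : R -> R) (a b c l s u v p q : R).

Definition exponent f s := log2 (f s) / log2 s.

Lemma exponentE f s : exponent f s = ln (f s) / ln s.
Proof.
by rewrite /exponent /log2 invf_div mulrA divfK// gt_eqF// ln_gt0// ltr1n.
Qed.

Lemma exponent_powR a : exponent (fun s => s `^ a) s @[s --> +oo] --> a.
Proof.
have H : a @[_ --> (+oo : set_system R)] --> a by exact: cvg_cst.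
move: H; apply: cvg_trans; apply: near_eq_cvg; near=> s.
have l0 : 0 < ln s by apply: ln_gt0; near: s; exact: nbhs_pinfty_gt.
by rewrite exponentE ln_powR mulfK// gt_eqF.
Unshelve. all: by end_near. Qed.

Lemma exponent_cst c : 0 < c -> exponent (fun=> c) s @[s --> +oo] --> (0 : R).
Proof.
move=> c0; apply/cvgr0Pnorm_le => eps eps0; near=> s.
have ls : `|ln c| / eps < ln s.
  rewrite -ltr_expR lnK; last by rewrite posrE; near: s; exact: nbhs_pinfty_gt.
  by near: s; apply: nbhs_pinfty_gt; rewrite num_real.
have l0 : 0 < ln s by apply: le_lt_trans ls; rewrite divr_ge0// ltW.
rewrite exponentE normrM normfV (gtr0_norm l0) ler_pdivrMr// mulrC.
by rewrite -ler_pdivrMr// ltW.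
Unshelve. all: by end_near. Qed.

(** The power has exponent [a], so uniqueness of limits pins down the common limit. *)
Lemma exp_eq_powRP f a : f =.= (fun s => s `^ a) <->
  (\forall s \near +oo, 0 < f s) /\ exponent f s @[s --> +oo] --> a.
Proof.
split=> [[f0 _ [l [fl al]]]|[f0 fa]].
  split=> //; suff <- : l = a by [].
  by apply: (cvg_unique _ al); [exact: norm_hausdorff|exact: exponent_powR].
split=> //; last by exists a; split => //; exact: exponent_powR.
by near=> s; rewrite powR_gt0//; near: s; exact: nbhs_pinfty_gt.
Unshelve. all: by end_near. Qed.

Lemma exponent_max f g a b :
  (\forall s \near +oo, 0 < f s) -> (\forall s \near +oo, 0 < g s) ->
  exponent f s @[s --> +oo] --> a -> exponent g s @[s --> +oo] --> b ->
  exponent (fun s => Num.max (f s) (g s)) s @[s --> +oo] --> Num.max a b.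
Proof.
move=> f0 g0 fa gb; rewrite maxr_absE.
have H : (exponent f s + exponent g s + `|exponent f s - exponent g s|) / 2
    @[s --> +oo] --> (a + b + `|a - b|) / 2.
  apply: cvgMr_tmp; apply: cvgD; first exact: cvgD.
  by apply: cvg_norm; exact: cvgB.
move: H; apply: cvg_trans.
apply: near_eq_cvg; near=> s.
have fs : 0 < f s by near: s.
have gs : 0 < g s by near: s.
have l0 : 0 < ln s by apply: ln_gt0; near: s; exact: nbhs_pinfty_gt.
rewrite -maxr_absE !exponentE.
have [fg|gf] := leP (f s) (g s).
  by rewrite max_r// ler_pM2r ?invr_gt0// ler_ln.
by rewrite max_l// ler_pM2r ?invr_gt0// ler_ln// ltW.
Unshelve. all: by end_near. Qed.

Lemma exponent_sandwich f g c l : 0 < c ->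
  (\forall s \near +oo, 0 < f s) ->
  (\forall s \near +oo, f s <= g s <= c * f s) ->
  exponent f s @[s --> +oo] --> l -> exponent g s @[s --> +oo] --> l.
Proof.
move=> c0 f0 fg fl.
have cfl : (exponent (fun=> c) s + exponent f s) @[s --> +oo] --> l.
  by rewrite -[l]add0r; apply: cvgD => //; exact: exponent_cst.
apply: squeeze_cvgr fl cfl; near=> s.
have fs : 0 < f s by near: s.
have /andP[fgs gcs] : f s <= g s <= c * f s by near: s.
have gs : 0 < g s by exact: lt_le_trans fgs.
have l0 : 0 < ln s by apply: ln_gt0; near: s; exact: nbhs_pinfty_gt.
rewrite !exponentE -mulrDl !ler_pM2r ?invr_gt0// -lnM// ler_ln//.
  by rewrite fgs ler_ln// posrE mulr_gt0.
Unshelve. all: by end_near. Qed.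

Lemma exp_eq_max f g h a b c : 0 < c ->
  f =.= (fun s => s `^ a) -> g =.= (fun s => s `^ b) ->
  (\forall s \near +oo,
    Num.max (f s) (g s) <= h s <= c * Num.max (f s) (g s)) ->
  h =.= (fun s => s `^ Num.max a b).
Proof.
move=> c0 /exp_eq_powRP[f0 fa] /exp_eq_powRP[g0 gb] fgh.
have m0 : \forall s \near +oo, 0 < Num.max (f s) (g s).
  by apply: filterS f0 => s fs; rewrite lt_max fs.
apply/exp_eq_powRP; split.
  by apply: filterS (filterI m0 fgh) => s [ms /andP[+ _]]; exact: lt_le_trans.
by apply: (exponent_sandwich c0 m0 fgh); exact: exponent_max.
Qed.

Lemma max_sandwich u v p q : 0 < u -> 0 < v -> u <= p -> v <= q ->
  p <= u + 48 * v -> q <= v + 48 * u ->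
  Num.max u v <= Num.max p q <= 49 * Num.max u v.
Proof.
move=> u0 v0 up vq pu qv; rewrite ge_max !le_max.
by case: (leP u v) => uv; case: (leP p q) => pq; apply/andP; split; try lra;
  rewrite up vq ?orbT.
Qed.

End exponents.

Local Close Scope classical_set_scope.

Theorem mainTheorem8 (R : realType) (alpha r1 r2 : R)
    (X1 X2 : R -> {fset R[i]})
    (halpha : 2 <= alpha)
    (hr1 : 0 <= r1 <= 1) (hr2 : 0 <= r2 <= 1)
    (hX1 : codebooks r1 X1) (hX2 : codebooks r2 X2)
    (hopt1 : siso_dmt_optimal r1 X1) (hopt2 : siso_dmt_optimal r2 X2) :
  ic_error alpha X1 X2 =.=
    (fun s => s `^ (- Num.min (pos_part (1 - r1)) (pos_part (1 - r2)))).
Proof.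
have [[c1 _ _] b1] := hX1; have [[c2 _ _] b2] := hX2.
have [e1 _ _] := hopt1; have [e2 _ _] := hopt2.
rewrite oppr_min; apply: (exp_eq_max _ hopt1 hopt2); first exact: (ltr0Sn R 48).
apply: filterS (filterI (filterI e1 e2) (filterI (filterI c1 c2)
  (nbhs_pinfty_ge (num_real (1 : R))))) => s [[h1 h2] [[k1 k2] s1]].
have s0 : 0 < s by exact: lt_le_trans s1.
have X10 : X1 s != fset0 by rewrite -cardfs_gt0 -(ltr0n R).
have X20 : X2 s != fset0 by rewrite -cardfs_gt0 -(ltr0n R).
have L1 := siso_error_le_stripping_error alpha (X1 s) (ltW s0) X20.
have L2 := siso_error_le_stripping_error alpha (X2 s) (ltW s0) X10.
have U1 := stripping_error_le s1 halpha X10 X20 (b1 s s0).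
have U2 := stripping_error_le s1 halpha X20 X10 (b2 s s0).
exact: (max_sandwich h1 h2 L1 L2 U1 U2).
Qed.
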